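(* Let $S\subset\mathbb{R}^n$ be a nonempty convex set, let $F=\{f_1,f_2,\dots,f_m\}$ be a finite set of functions $f_i:\mathbb{R}^n\to\mathbb{R}^n$, and let $\mathcal{D}$ be a fixed probability distribution on $\{1,\dots,m\}$. Let $\mathbf{x}_0\in\mathbb{R}^n$ be a fixed vector and consider the stochastic process $\{\mathbf{x}_k:k\in\mathbb{N}\}$ defined by $\mathbf{x}_k=f_{i_k}(\mathbf{x}_{k-1})$, where the indices $i_k$ are selected independently at each time $k$ according to $\mathcal{D}$. Let $d(\mathbf{x},S):=\inf_{\mathbf{s}\in S}\|\mathbf{x}-\mathbf{s}\|$ denote the distance to $S$ with respect to a vector norm $\|\cdot\|$ on $\mathbb{R}^n$. Suppose that there is some $r\in(0,1)$ such that, for all $k$, $$\mathbb{E}[d(\mathbf{x}_k,S)^2]\le r^k d(\mathbf{x}_0,S)^2,$$ and that there exists some constant $D$ such that $\sup_{k\in\mathbb{N}}d(\mathbf{x}_k,S)\le D$. Then, for all $k$, $$\operatorname{Var}\left(d(\mathbf{x}_k,S)^2\right)\le D^2 r^k d(\mathbf{x}_0,S)^2 .$$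
   Context: Here $\|\cdot\|$ is an arbitrary norm on $\mathbb{R}^n$. The constant $D$ is deterministic, and the bound $\sup_{k}d(\mathbf{x}_k,S)\le D$ is understood to hold almost surely. *)

(* Defs.v *)
From mathcomp Require Import all_boot all_order all_algebra.
From mathcomp Require Import finmap.
From mathcomp Require Import all_classical all_reals all_analysis.

Set Implicit Arguments.
Unset Strict Implicit.
Unset Printing Implicit Defensive.

Import Order.TTheory GRing.Theory Num.Theory.

Local Open Scope classical_set_scope.
Local Open Scope ring_scope.

(* The norm is an arbitrary function N, since the canonical norm of 'rV[R]_n
   in the library is the sup norm. Nonnegativity follows from the axioms. *)
Record is_vector_norm (R : realType) (n : nat) (N : 'rV[R]_n -> R) : Prop := {
  vnorm_triangle : forall x y, N (x + y) <= N x + N y;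
  vnormZ : forall (a : R) x, N (a *: x) = `|a| * N x;
  vnorm_eq0 : forall x, N x = 0 -> x = 0 }.

Definition dist_to (R : realType) (n : nat) (N : 'rV[R]_n -> R)
    (S : set 'rV[R]_n) (x : 'rV[R]_n) : R :=
  inf [set N (x - s) | s in S].

Definition is_distribution (R : realType) (m : nat) (p : 'I_m -> R) : Prop :=
  (forall j, 0 <= p j) /\ \sum_j p j = 1.

Definition mutually_independent (d : measure_display) (T : measurableType d)
    (R : realType) (P : probability T R) (m : nat) (i : nat -> T -> 'I_m) : Prop :=
  forall (K : {fset nat}) (A : nat -> set 'I_m),
    P (\bigcap_(k in [set` K]) (i k @^-1` A k)) =
    (\prod_(k <- K) P (i k @^-1` A k))%E.

Definition iid_indices (d : measure_display) (T : measurableType d)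
    (R : realType) (P : probability T R) (m : nat) (p : 'I_m -> R)
    (i : nat -> T -> 'I_m) : Prop :=
  [/\ forall k j, measurable (i k @^-1` [set j]),
      forall k j, P (i k @^-1` [set j]) = (p j)%:E
    & mutually_independent P i].

(* i k is the index drawn at time k + 1, so that the family i consists exactly
   of the indices selected at the times 1, 2, 3, and so on. *)
Fixpoint process (R : realType) (n m : nat) (T : Type)
    (f : 'I_m -> 'rV[R]_n -> 'rV[R]_n) (x0 : 'rV[R]_n)
    (i : nat -> T -> 'I_m) (k : nat) (w : T) : 'rV[R]_n :=
  if k is k'.+1 then f (i k' w) (process f x0 i k' w) else x0.

(* Main.v *)
Require Import Defs.
From mathcomp Require Import all_boot all_order all_algebra.
From mathcomp Require Import all_classical all_reals all_analysis.
From mathcomp Require Import measurable_realfun.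

(** Write [X] for the squared distance [d(x_k, S)^2].  Dropping the square of
    the mean, [Var X <= E(X^2)]; and since [0 <= X <= D^2] almost surely,
    [X^2 <= D^2 X] almost surely, so that [E(X^2) <= D^2 E(X)].  The assumed
    decay of [E(X)] then gives the bound.  The inequality
    [Var X <= D^2 E(X)] is [variance_le_bound_expectation]; it is valid for every
    nonnegative, essentially bounded random variable.

    What has to be checked is that [X] is a random variable at all, the maps
    [f j] being arbitrary functions.  The reason is that [x_k] depends only on
    finitely many indices, each with finitely many values: it takes finitely
    many values, each on a measurable event, and thus the preimage under [x_k]
    of any set whatsoever is measurable ([measurable_process_preimage]). *)

Set Implicit Arguments.
Unset Strict Implicit.
Unset Printing Implicit Defensive.

Import Order.TTheory GRing.Theory Num.Theory.

Local Open Scope classical_set_scope.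
Local Open Scope ring_scope.

(** Homogeneity makes [N] even, so [0 = N (x - x) <= N x + N (- x) = 2 N x]. *)
Lemma vector_norm_ge0 (R : realType) (n : nat) (N : 'rV[R]_n -> R) :
  is_vector_norm N -> forall x, 0 <= N x.
Proof.
move=> [triN homN _] x.
have N0 : N 0 = 0 by rewrite -(scale0r 0) homN normr0 mul0r.
have := triN x (- x); rewrite subrr N0 -scaleN1r homN normrN1 mul1r -mulr2n.
by rewrite pmulrn_lge0.
Qed.

Lemma dist_to_ge0 (R : realType) (n : nat) (N : 'rV[R]_n -> R)
    (S : set 'rV[R]_n) (x : 'rV[R]_n) :
  is_vector_norm N -> S !=set0 -> 0 <= dist_to N S x.
Proof.
move=> hN [s Ss]; apply: lb_le_inf; first by exists (N (x - s)); exists s.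
by move=> _ [t _ <-]; exact: vector_norm_ge0.
Qed.

(** The set [A] is arbitrary, which is what lets the induction on [k] pass from
    [A] to its preimages under the maps [f j], of which nothing is assumed. *)
Lemma measurable_process_preimage (R : realType) (n m : nat)
    (d : measure_display) (T : measurableType d)
    (f : 'I_m -> 'rV[R]_n -> 'rV[R]_n) (x0 : 'rV[R]_n) (i : nat -> T -> 'I_m) :
  (forall k j, measurable (i k @^-1` [set j])) ->
  forall k (A : set 'rV[R]_n), measurable (process f x0 i k @^-1` A).
Proof.
move=> mi; elim=> [|k IHk] A; first by rewrite preimage_cst; case: ifP.
(* split the event according to the last index drawn *)
rewrite [X in measurable X](_ : _ = \bigcup_j
    (i k @^-1` [set j] `&` process f x0 i k @^-1` (f j @^-1` A))).
  by apply: fin_bigcup_measurable => // j _; exact: measurableI.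
apply/seteqP; split=> [w Aw|w [j _ [/= <-]]] //.
by exists (i k w).
Qed.

Lemma measurable_fun_process (R : realType) (n m : nat)
    (d : measure_display) (T : measurableType d)
    (f : 'I_m -> 'rV[R]_n -> 'rV[R]_n) (x0 : 'rV[R]_n) (i : nat -> T -> 'I_m)
    (g : 'rV[R]_n -> R) (k : nat) :
  (forall k j, measurable (i k @^-1` [set j])) ->
  measurable_fun [set: T] (fun w => g (process f x0 i k w)).
Proof.
move=> mi _ B _; rewrite setTI.
exact: (measurable_process_preimage f x0 mi k (g @^-1` B)).
Qed.

(** A bounded function is integrable for a probability, since its expectation is
    at most the bound. *)
Lemma bounded_Lfun1 (R : realType) (d : measure_display) (T : measurableType d)
    (P : probability T R) (X : T -> R) (c : R) :
  measurable_fun [set: T] X -> (forall w, 0 <= X w) -> 0 <= c ->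
  {ae P, forall w, X w <= c} -> X \in Lfun P 1.
Proof.
move=> mX X0 c0 Xc; apply/Lfun1_integrable/integrableP; split.
  exact/measurable_EFinP.
have EXc : ('E_P[X] <= c%:E)%E.
  by rewrite -(expectation_cst P c); exact: expectation_le.
rewrite (le_lt_trans _ (ltry c))// (le_trans _ EXc)// unlock.
by under eq_integral => w _ do rewrite /= ger0_norm//.
Qed.

(** [Var X <= E(X^2) <= c E(X)], because [X^2 <= c X] where [0 <= X <= c]. *)
Lemma variance_le_bound_expectation (R : realType) (d : measure_display)
    (T : measurableType d) (P : probability T R) (X : T -> R) (c : R) :
  measurable_fun [set: T] X -> (forall w, 0 <= X w) -> 0 <= c ->
  {ae P, forall w, X w <= c} -> ('V_P[X] <= c%:E * 'E_P[X])%E.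
Proof.
move=> mX X0 c0 Xc.
have X1 : X \in Lfun P 1 by exact: bounded_Lfun1 Xc.
have mXX : measurable_fun [set: T] (X * X) by exact: measurable_funM.
have XX0 w : 0 <= (X * X) w by exact: mulr_ge0.
have XX1 : X * X \in Lfun P 1.
  apply: (bounded_Lfun1 (c := c * c)) => //; first exact: mulr_ge0.
  by apply: filterS Xc => w Xwc; exact: ler_pM.
rewrite /variance covarianceE// -expectationZl//.
apply: (@le_trans _ _ ('E_P[X * X])%E).
  by rewrite leeBlDr ?leeDl ?mule_ge0 ?expectation_ge0 ?fin_numM ?expectation_fin_num.
apply: expectation_le => //.
- exact: measurable_funM.
- by move=> w; exact: mulr_ge0.
- by apply: filterS Xc => w Xwc; exact: ler_wpM2l.
Qed.

Theorem theorem1p4 (R : realType) (n m : nat)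
    (N : 'rV[R]_n -> R) (hN : is_vector_norm N)
    (S : set 'rV[R]_n) (hS0 : S !=set0) (hS : convex_set S)
    (f : 'I_m -> 'rV[R]_n -> 'rV[R]_n)
    (p : 'I_m -> R) (hp : is_distribution p)
    (d : measure_display) (Omega : measurableType d) (P : probability Omega R)
    (i : nat -> Omega -> 'I_m) (hi : iid_indices P p i)
    (x0 : 'rV[R]_n)
    (r : R) (hr0 : 0 < r) (hr1 : r < 1)
    (hE : forall k : nat,
      ('E_P[fun w => (dist_to N S (process f x0 i k w) ^+ 2)%R]
         <= (r ^+ k * dist_to N S x0 ^+ 2)%:E)%E)
    (D : R)
    (hD : {ae P, forall w,
      (ereal_sup (range (fun k : nat =>
          (dist_to N S (process f x0 i k w))%:E)) <= D%:E)%E}) :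
  forall k : nat,
    ('V_P[fun w => (dist_to N S (process f x0 i k w) ^+ 2)%R]
       <= (D ^+ 2 * r ^+ k * dist_to N S x0 ^+ 2)%:E)%E.
Proof.
move=> k; have [mi _ _] := hi.
have dist0 x : 0 <= dist_to N S x by exact: dist_to_ge0.
have VE : ('V_P[fun w => (dist_to N S (process f x0 i k w) ^+ 2)%R]
    <= (D ^+ 2)%:E * 'E_P[fun w => (dist_to N S (process f x0 i k w) ^+ 2)%R])%E.
  apply: variance_le_bound_expectation.
  - exact: (measurable_fun_process f x0 (fun x => dist_to N S x ^+ 2)).
  - by move=> w; exact: sqr_ge0.
  - exact: sqr_ge0.
  - apply: filterS hD => w supD.
    suff distD : dist_to N S (process f x0 i k w) <= D.
      by rewrite lerXn2r// nnegrE// (le_trans (dist0 _) distD).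
    rewrite -lee_fin (le_trans _ supD)//.
    by apply: ereal_sup_ubound; exists k.
apply: (le_trans VE).
by rewrite -mulrA [leRHS]EFinM lee_wpmul2l// lee_fin sqr_ge0.
Qed.
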